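(* For each $N\ge1$ let $(x_1(t),\ldots,x_N(t))$ be the solution of the finite-network system $$\frac{dx_i}{dt}=f(x_i)+\frac1N\sum_{j=1}^N (W_N)_{ij}\,G(x_i,x_j),\qquad i=1,\ldots,N,$$ with $(W_N)_{ij}=N^2\int_{I_{N,i}\times I_{N,j}}W(y,y')\,\mathrm{d}y\,\mathrm{d}y'$, and set $x_N(y,t)=\sum_{i=1}^N x_i(t)\chi_{I_{N,i}}(y)$. Let $x(y,t)$ be the solution of the graphon dynamical system $$\frac{\partial x(y,t)}{\partial t}=f(x(y,t))+\int_0^1W(y,y')\,G(x(y,t),x(y',t))\,\mathrm{d}y'.$$ Suppose that the initial conditions satisfy $$\lim_{N\to\infty}\|x_N(\cdot,0)-x(\cdot,0)\|_{L^2(I)}=0.$$ Then, for any fixed $T>0$, $$\lim_{N\to\infty}\max_{t\in[0,T]}\|x_N(\cdot,t)-x(\cdot,t)\|_{L^2(I)}=0.$$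
   Context: $I=[0,1]$; $I_{N,i}=[\frac{i-1}{N},\frac iN)$ for $1\le i\le N-1$ and $I_{N,N}=[\frac{N-1}{N},1]$; $\chi_{I_{N,i}}$ is the indicator function of $I_{N,i}$. A graphon is a symmetric measurable function $W:I^2\to[0,1]$. Standing assumptions: (i) $\Omega\subset\mathbb R$ is a bounded closed interval; $f:\Omega\to\mathbb R$ satisfies $|f(x)-f(x')|\le L_f|x-x'|$ on $\Omega$; $G:\Omega\times\Omega\to\mathbb R$ satisfies $|G(u,v)-G(u',v')|\le L_G\|(u,v)-(u',v')\|_2$ on $\Omega\times\Omega$. (ii) The set $S=\{u\in L^2(I):u(y)\in\Omega\text{ for a.e. }y\in I\}$ is positively invariant for the graphon dynamical system: if $x(\cdot,0)\in S$, then $x(\cdot,t)\in S$ for all $t\ge0$. (iii) $W$ is a graphon that is continuous at almost every point of $I^2$. All solutions considered (of the finite-network and of the graphon system) take values in $\Omega$ (for a.e. $y$), so that $f$ and $G$ are evaluated only on their domains; they are defined for all $t\ge0$ and are $C^1$ in time (as $\mathbb R^N$-valued and $L^2(I)$-valued maps, respectively). *)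

(* Defs.v *)
From HB Require Import structures.
From mathcomp Require Import all_boot all_order all_algebra.
From mathcomp Require Import all_classical all_reals all_analysis.
Set Implicit Arguments.
Unset Strict Implicit.
Unset Printing Implicit Defensive.
Import Order.TTheory GRing.Theory Num.Theory.
Import numFieldNormedType.Exports.
Local Open Scope classical_set_scope.
Local Open Scope ring_scope.

(* A function on I = [0,1] is encoded as a total function on R, and a function
   on I^2 as one on R * R; values off I, resp. I^2, play no role. An element of
   L^2(I) is given by a representative that is Borel on R (extend it by 0 off I),
   square integrable for lebI, the Lebesgue measure restricted to I. *)
Definition unitI (R : realType) : set R := `[0, 1]%classic.

Definition sqI (R : realType) : set (R * R) := @unitI R `*` @unitI R.

Definition lebI (R : realType) :=
  mrestr (@lebesgue_measure R) (measurable_itv `[0, 1] : measurable (@unitI R)).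
HB.instance Definition _ (R : realType) := Measure.on (@lebI R).

Definition L2norm (R : realType) (u : R -> R) : \bar R :=
  ('N[@lebI R]_2%:E [EFin \o u])%E.

Definition inL2 (R : realType) (u : R -> R) : Prop := u \in Lfun (@lebI R) 2%:E.

(* The N cells are numbered from 0: cell N i is the interval I_{N,i+1}. *)
Definition cell (R : realType) (N : nat) (i : 'I_N) : set R :=
  if i.+1 == N then `[i%:R / N%:R, 1]%classic
  else `[i%:R / N%:R, i.+1%:R / N%:R[%classic.

Definition graphon (R : realType) (W : R * R -> R) : Prop :=
  [/\ measurable_fun (@sqI R) W,
      (forall y y', unitI y -> unitI y' -> W (y, y') = W (y', y)) &
      (forall y y', unitI y -> unitI y' -> 0 <= W (y, y') <= 1)].

Definition ae_continuous (R : realType) (W : R * R -> R) : Prop :=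
  {ae (@lebesgue_measure R \x @lebesgue_measure R)%E, forall p, @sqI R p ->
    W q @[q --> within (@sqI R) (nbhs p)] --> W p}.

Definition WN (R : realType) (W : R * R -> R) (N : nat) : 'M[R]_N :=
  \matrix_(i, j) (N%:R ^+ 2 *
    \int[(@lebesgue_measure R \x @lebesgue_measure R)%E]_(p in
      cell i `*` cell j) W p).

Definition step (R : realType) (N : nat) (v : 'rV[R]_N) (y : R) : R :=
  \sum_(i < N) v 0 i * \1_(cell i) y.

(* Increments h such that t + h is still a time of [0, +oo[; at t = 0 the limit
   along this filter is one-sided. *)
Definition increments (R : realType) (t : R) : set_system R :=
  within [set h | 0 <= t + h] 0^'.

Definition network_rhs (R : realType) (f : R -> R) (G : R -> R -> R)
    (W : R * R -> R) (N : nat) (v : 'rV[R]_N) : 'rV[R]_N :=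
  \row_i (f (v 0 i) + N%:R^-1 * \sum_(j < N) WN W N i j * G (v 0 i) (v 0 j)).

Definition network_solution (R : realType) (Omega : set R) (f : R -> R)
    (G : R -> R -> R) (W : R * R -> R) (N : nat) (x : R -> 'rV[R]_N) : Prop :=
  [/\ (forall t i, 0 <= t -> Omega (x t 0 i)),
      (forall t, 0 <= t ->
        h^-1 *: (x (t + h) - x t) @[h --> increments t]
          --> network_rhs f G W (x t)) &
      {within [set t | 0 <= t],
        continuous (fun t => network_rhs f G W (x t))}].

Definition graphon_rhs (R : realType) (f : R -> R) (G : R -> R -> R)
    (W : R * R -> R) (u : R -> R) (y : R) : R :=
  f (u y) + \int[@lebesgue_measure R]_(y' in @unitI R) (W (y, y') * G (u y) (u y')).

Definition inS (R : realType) (Omega : set R) (u : R -> R) : Prop :=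
  inL2 u /\ {ae @lebI R, forall y, Omega (u y)}.

(* x' is the time derivative of x in L^2(I); the time argument comes first. *)
Definition graphon_solution (R : realType) (Omega : set R) (f : R -> R)
    (G : R -> R -> R) (W : R * R -> R) (x : R -> R -> R) : Prop :=
  (forall t, 0 <= t -> inS Omega (x t)) /\
  exists x' : R -> R -> R,
  [/\ (forall t, 0 <= t -> inL2 (x' t)),
      (forall t, 0 <= t ->
        L2norm (h^-1 *: (x (t + h) - x t) - x' t) @[h --> increments t]
          --> 0%E),
      (forall t, 0 <= t ->
        L2norm (x' s - x' t) @[s --> within [set s | 0 <= s] (nbhs t)]
          --> 0%E) &
      (forall t, 0 <= t ->
        {ae @lebI R, forall y, x' t y = graphon_rhs f G W (x t) y})].

(* f and G are meaningful on Omega only, so that solutions are required to take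
   values in Omega; this makes the condition automatic. *)
Definition positively_invariant (R : realType) (Omega : set R) (f : R -> R)
    (G : R -> R -> R) (W : R * R -> R) : Prop :=
  forall x, graphon_solution Omega f G W x -> inS Omega (x 0) ->
  forall t, 0 <= t -> inS Omega (x t).

Definition is_max (R : realType) (A : set (\bar R)) (m : \bar R) : Prop :=
  A m /\ ubound A m.

(* Main.v *)
Require Import Defs.
From HB Require Import structures.
From mathcomp Require Import all_boot all_order all_algebra.
From mathcomp Require Import all_classical all_reals all_analysis.
From mathcomp Require Import measurable_realfun.
From mathcomp Require Import ring lra.
Import Order.TTheory GRing.Theory Num.Theory.
Import numFieldNormedType.Exports.
Local Open Scope classical_set_scope.
Local Open Scope ring_scope.
Set Implicit Arguments.
Unset Strict Implicit.
Unset Printing Implicit Defensive.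

(** Write u for the step function of the network state, v for the graphon
    solution and V for the step kernel whose values are the cell averages of W.
    Because the integral over I of a step function is the mean of its values,
    u solves the graphon equation with V in place of W (step_network_rhs): both
    curves obey the same evolution equation in L^2(I), with different kernels.

    Two right-hand sides are compared pointwise (graphon_rhs_dist). Lipschitz
    continuity of f and G controls the change of state by a multiple of
    |u - v|, and boundedness of G on the compact square Omega x Omega controls
    the change of kernel by C times the row integral of |V - W|. In L^2(I) this
    gives, with D the L^1(I^2) distance of V and W,
      |d(u - v)/dt| <= K |u - v| + C sqrt(2 D)
    (network_error_derivative), where the last term does not depend on time.

    The norm of a differentiable curve grows at most as fast as the norm of its
    derivative (nrm_increment, the triangle inequality), so a Gronwall argument
    for one-sided difference quotients (gronwall_dini) bounds |u - v| on [0,T]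
    by a fixed multiple of the sum of the initial error, C sqrt(2 D) and an
    arbitrarily small positive number. Finally D tends to 0: at a point of
    continuity of W the averages over shrinking cells converge to the value of
    W, almost every point is such a point, and everything is bounded by 1
    (step_kernel_WN_L1, dominated convergence).

    The functions f and G are only controlled on Omega. Composing them with the
    nearest-point projection onto Omega makes them Lipschitz on the whole line
    and changes the equations only on null sets; since the original integrands
    may fail to be measurable, this rests on integral_eq_off_null, which holds
    for arbitrary functions. *)

(** * Integrals on a restricted measure and null sets *)

Section Restriction.
Context d (T : measurableType d) (R : realType).
Variables (mu : {measure set T -> \bar R}).
Import HBNNSimple.
Local Open Scope ereal_scope.

Lemma sintegral_mrestr (D : set T) (mD : measurable D) (h : {nnsfun T >-> R}) :
  sintegral (mrestr mu mD) h = sintegral mu (proj_nnsfun h mD).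
Proof.
rewrite /sintegral -mrestrict; apply: eq_fsbigr => r _.
have [->|r0] := eqVneq r 0%R; first by rewrite !mul0e.
congr (_ * mu _); apply/seteqP; split => [x [/= hx Dx]|x /=].
  by rewrite patchT// inE.
rewrite /patch; case: ifPn => [|_ /esym/eqP]; first by rewrite inE.
by rewrite (negbTE r0).
Qed.

(** The simple functions below f and those below its restriction to D have the
    same integrals, by truncation to D; this works for an arbitrary f. *)
Lemma integral_mrestr (D : set T) (mD : measurable D) (f : T -> \bar R) :
  \int[mrestr mu mD]_x f x = \int[mu]_(x in D) f x.
Proof.
have sup_eq (g : T -> \bar R) : (forall x, 0 <= g x) ->
  [set sintegral (mrestr mu mD) h |
    h in [set h : {nnsfun T >-> R} | forall x, (h x)%:E <= g x]] =
  [set sintegral mu h |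
    h in [set h : {nnsfun T >-> R} | forall x, (h x)%:E <= (g \_ D) x]].
  move=> g0; apply/seteqP; split => _ [h /= hg <-].
    exists (proj_nnsfun h mD); last by rewrite sintegral_mrestr.
    by move=> x; rewrite -mrestrict /patch; case: ifP.
  exists h => [x|].
    apply: (le_trans (hg x)); rewrite /patch; case: ifP => //.
  rewrite sintegral_mrestr -mrestrict; congr (sintegral mu _); apply/funext => x.
  rewrite {1}/patch; case: ifPn => // xD; apply/esym/eqP.
  rewrite eq_le fun_ge0 andbT.
  by have := hg x; rewrite /patch (negbTE xD) lee_fin.
rewrite /integral patch_setT funepos_restrict funeneg_restrict.
by rewrite !sup_eq.
Qed.

(** Restricting the measure to the complement of a null set N does not change
    it, so the integral of any function is its integral over the complement of
    N. The functions are arbitrary because an integrand such as G o (x t) is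
    controlled only almost everywhere and may fail to be measurable. *)
Lemma integral_eq_off_null (D N : set T) (f g : T -> \bar R) :
  measurable N -> mu N = 0 -> (forall x, D x -> ~ N x -> f x = g x) ->
  \int[mu]_(x in D) f x = \int[mu]_(x in D) g x.
Proof.
move=> mN N0 fg.
have restrE (h : T -> \bar R) :
    \int[mu]_(x in D) h x = \int[mu]_(x in ~` N) (h \_ D) x.
  rewrite integral_mkcond -(integral_mrestr (measurableC mN)).
  apply: eq_measure_integral => A mA _ /=; rewrite /mrestr.
  rewrite [LHS](measureDI mu mA mN) setDE [X in _ + X = _](_ : _ = 0) ?adde0//.
  apply/eqP; rewrite eq_le measure_ge0 andbT -N0 le_measure// ?inE//.
  exact: measurableI.
rewrite !restrE; apply: eq_integral => x; rewrite inE => Nx.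
by rewrite /patch; case: ifP => //; rewrite inE => Dx; exact: fg.
Qed.

End Restriction.

(** * The space L^2(I) *)

Section L2.
Context (R : realType).
Implicit Types u v w : R -> R.

Local Notation mu := (@lebesgue_measure R).

(** The real value of the L^2 norm; it is meaningful on inL2 (nrmE). *)
Definition nrm u : R := fine (L2norm u).

Lemma measurable_unitI : measurable (@unitI R).
Proof. exact: measurable_itv. Qed.

Lemma lebesgue_unitI : mu (@unitI R) = 1%:E.
Proof. by rewrite /unitI lebesgue_measure_itv/= lte_fin ltr01 sube0. Qed.

Lemma integral_lebI (f : R -> \bar R) :
  (\int[@lebI R]_y f y = \int[mu]_(y in @unitI R) f y)%E.
Proof. exact: integral_mrestr. Qed.

Lemma lebI_setT : @lebI R setT = 1%:E.
Proof. by rewrite /lebI /mrestr setTI lebesgue_unitI. Qed.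

Lemma aeI (P : R -> Prop) :
  (forall y, unitI y -> P y) -> {ae @lebI R, forall y, P y}.
Proof.
move=> IP; exists (~` @unitI R); split.
- exact: measurableC measurable_unitI.
- by rewrite /lebI /mrestr setICl measure0.
- by move=> y /= nPy Iy; apply: nPy; exact: IP.
Qed.

Lemma ae_lebI_imply (P Q : R -> Prop) : (forall y, P y -> Q y) ->
  {ae @lebI R, forall y, P y} -> {ae @lebI R, forall y, Q y}.
Proof.
by move=> PQ; apply: filterS => //; exact: (ae_filter_ringOfSetsType (@lebI R)).
Qed.

Lemma ae_lebI_and (P Q : R -> Prop) :
  {ae @lebI R, forall y, P y} -> {ae @lebI R, forall y, Q y} ->
  {ae @lebI R, forall y, P y /\ Q y}.
Proof.
by move=> aP aQ; apply: filterI => //; exact: (ae_filter_ringOfSetsType (@lebI R)).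
Qed.

Lemma L2norm_ge0 u : (0 <= L2norm u)%E.
Proof. exact: Lnorm_ge0. Qed.

Lemma inL2P u : inL2 u <-> measurable_fun setT u /\ (L2norm u < +oo)%E.
Proof.
rewrite /inL2 inE; split.
  by move=> /andP[]; rewrite !inE.
by move=> [mu_ fu]; apply/andP; split; rewrite inE.
Qed.

Lemma inL2_measurable u : inL2 u -> measurable_fun setT u.
Proof. by move=> /inL2P[]. Qed.

Lemma nrmE u : inL2 u -> L2norm u = (nrm u)%:E.
Proof.
by move=> /inL2P[_ fu]; rewrite /nrm fineK// ge0_fin_numE ?L2norm_ge0.
Qed.

Lemma nrm_ge0 u : 0 <= nrm u.
Proof. by rewrite /nrm fine_ge0 ?L2norm_ge0. Qed.

(** Passage from the L^2 norm to an integral over I, on which monotonicity and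
    Fubini arguments operate. *)
Lemma L2norm_sqr u :
  (L2norm u `^ 2 = \int[mu]_(y in @unitI R) (u y ^+ 2)%:E)%E.
Proof.
rewrite /L2norm poweR_Lnorm ?pnatr_eq0// integral_lebI.
apply: eq_integral => y _ /=.
by rewrite powR_mulrn// real_normK// num_real.
Qed.

Lemma L2norm_le u v : measurable_fun setT u -> measurable_fun setT v ->
  {ae @lebI R, forall y, `|u y| <= `|v y|} -> (L2norm u <= L2norm v)%E.
Proof.
move=> mu_ mv uv; rewrite /L2norm unlock gt0_ler_poweR ?invr_ge0//.
- by rewrite in_itv/= leey andbT integral_ge0.
- by rewrite in_itv/= leey andbT integral_ge0.
have meas w : measurable_fun setT w ->
    measurable_fun setT (fun y => `|(EFin \o w) y| `^ 2)%E.
  move=> mw.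
  apply: (@measurableT_comp _ _ _ _ _ _ (fun x : \bar R => x `^ 2)%E) => //=.
    exact: measurable_poweR.
  by apply: measurableT_comp => //; exact: measurableT_comp.
apply: ae_ge0_le_integral => //.
- by move=> y _ /=; rewrite lee_fin powR_ge0.
- exact: meas.
- by move=> y _ /=; rewrite lee_fin powR_ge0.
- exact: meas.
move: uv; apply: ae_lebI_imply => y uvy _ /=.
by rewrite lee_fin ge0_ler_powR// nnegrE.
Qed.

Lemma L2norm_cst (c : R) : (L2norm (cst c) = `|c|%:E)%E.
Proof.
rewrite /L2norm unlock.
under eq_integral do rewrite /=.
rewrite integral_cst//= lebI_setT mule1.
by rewrite poweR_EFin -powRrM mulfV ?powRr1 ?pnatr_eq0.
Qed.

Lemma inL2_le u v : measurable_fun setT u -> inL2 v ->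
  {ae @lebI R, forall y, `|u y| <= `|v y|} -> inL2 u.
Proof.
move=> mu_ /inL2P[mv fv] uv; apply/inL2P; split => //.
exact: le_lt_trans (L2norm_le mu_ mv uv) fv.
Qed.

Lemma nrm_le u v : measurable_fun setT u -> inL2 v ->
  {ae @lebI R, forall y, `|u y| <= `|v y|} -> nrm u <= nrm v.
Proof.
move=> mu_ Lv uv; have Lu := inL2_le mu_ Lv uv.
rewrite -lee_fin -!nrmE//; apply: L2norm_le => //; exact: inL2_measurable.
Qed.

Lemma inL2_cst c : inL2 (cst c : R -> R).
Proof. by apply/inL2P; split => //; rewrite L2norm_cst ltry. Qed.

Lemma nrm_cst c : nrm (cst c : R -> R) = `|c|.
Proof. by rewrite /nrm L2norm_cst. Qed.

Lemma inL2D u v : inL2 u -> inL2 v -> inL2 (u + v).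
Proof. exact: (Lfun_addr_closed _ (lee1n 2)).2. Qed.

Lemma inL2N u : inL2 u -> inL2 (- u).
Proof. exact: (@Lfun_oppr_closed _ _ _ (@lebI R) 2%:E). Qed.

Lemma inL2B u v : inL2 u -> inL2 v -> inL2 (u - v).
Proof. by move=> Lu Lv; apply: inL2D => //; exact: inL2N. Qed.

Lemma inL2Z c u : inL2 u -> inL2 (c *: u).
Proof.
move=> Lu; have [L0 Lcl] := @Lfun_submod_closed _ _ _ (@lebI R) _ (lee1n 2).
by rewrite -[_ *: _]addr0; exact: Lcl.
Qed.

Lemma nrmD u v : inL2 u -> inL2 v -> nrm (u + v) <= nrm u + nrm v.
Proof.
move=> Lu Lv; rewrite -lee_fin EFinD -!nrmE//; last exact: inL2D.
by apply: eminkowski; [exact: inL2_measurable|exact: inL2_measurable|exact: lee1n].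
Qed.

Lemma nrmZ c u : inL2 u -> nrm (c *: u) = `|c| * nrm u.
Proof.
move=> Lu; apply: EFin_inj; rewrite EFinM -!nrmE//; last exact: inL2Z.
exact: (LnormZ (Lfun_Sub (lee1n 2) Lu)).
Qed.

Lemma nrmN u : inL2 u -> nrm (- u) = nrm u.
Proof. by move=> Lu; rewrite -scaleN1r nrmZ// normrN1 mul1r. Qed.

Lemma nrmB u v : inL2 u -> inL2 v -> nrm (u - v) <= nrm u + nrm v.
Proof.
by move=> Lu Lv; rewrite -(nrmN Lv); apply: nrmD => //; exact: inL2N.
Qed.

Lemma nrm_distC u v : inL2 u -> inL2 v -> nrm (u - v) = nrm (v - u).
Proof. by move=> Lu Lv; rewrite -nrmN ?opprB//; exact: inL2B. Qed.

(** Hoelder's inequality against the constant 1, whose norm is 1. *)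
Lemma integral_norm_le_nrm u : inL2 u ->
  (\int[mu]_(y in @unitI R) `|u y|%:E <= (nrm u)%:E)%E.
Proof.
move=> Lu; rewrite -integral_lebI -nrmE//.
have := @hoelder _ _ _ (@lebI R) u (cst 1) 2 2 (inL2_measurable Lu).
move=> /(_ (measurable_cst _) (ltr0Sn _ 1) (ltr0Sn _ 1)).
rewrite -/(L2norm _) -/(L2norm (cst 1)) L2norm_cst normr1 mule1.
rewrite Lnorm1 => H; apply: le_trans (H _); last by rewrite [RHS]splitr !div1r.
by rewrite le_eqVlt; apply/orP; left; apply/eqP/eq_integral => y _ /=; rewrite mulr1.
Qed.

Lemma integrable_unitI u : inL2 u -> mu.-integrable (@unitI R) (EFin \o u).
Proof.
move=> Lu; apply/integrableP; split.
  apply: measurableT_comp => //.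
  apply: measurable_funTS; exact: inL2_measurable.
by apply: le_lt_trans (integral_norm_le_nrm Lu) _; rewrite ltry.
Qed.

Lemma integrable_unitI_bounded (f : R -> R) (C : R) :
  measurable_fun (@unitI R) f -> (forall y, unitI y -> `|f y| <= C) ->
  mu.-integrable (@unitI R) (EFin \o f).
Proof.
move=> mf fC; apply: measurable_bounded_integrable => //.
- exact: measurable_unitI.
- by rewrite [ltLHS]lebesgue_unitI ltry.
exists C; split; first exact: num_real.
by move=> M CM y Iy; apply: (le_trans (fC _ Iy)); exact: ltW.
Qed.

Lemma Rintegral_norm_le_nrm u : inL2 u ->
  \int[mu]_(y in @unitI R) `|u y| <= nrm u.
Proof.
move=> Lu; rewrite -lee_fin fineK ?integral_norm_le_nrm//.
apply: integrable_fin_num; first exact: measurable_unitI.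
exact/integrable_norm/integrable_unitI.
Qed.

End L2.

(** * A Gronwall inequality for difference quotients *)

Section Gronwall.
Context (R : realType).

(** The barrier B t = A exp((L+1) t) satisfies B' = (L+1) B >= L B + A, and
    A > c leaves a margin in the differential inequality. Let s0 be the
    supremum of the times at which phi <= B. Then phi s0 <= B s0 by continuity,
    and if s0 were less than T one step of the difference inequality, with the
    margin A - c as error term, would keep phi below B beyond s0. *)
Lemma gronwall_dini (phi : R -> R) (L c A T : R) : 0 <= L -> 0 <= A ->
  (forall t, 0 <= t -> forall e, 0 < e -> exists2 d, 0 < d &
    forall s, 0 <= s -> `|s - t| < d -> `|phi s - phi t| <= e) ->
  (forall t, 0 <= t -> forall e, 0 < e -> exists2 d, 0 < d &
    forall h, 0 < h -> h < d -> phi (t + h) <= phi t + h * (L * phi t + c + e)) ->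
  phi 0 <= A -> c < A -> 0 <= T ->
  phi T <= A * expR ((L + 1) * T).
Proof.
move=> L0 A0 phic phid phi0 cA T0.
pose B t := A * expR ((L + 1) * t).
have BA t : 0 <= t -> A <= B t.
  move=> t0; rewrite ler_peMr// -expR0 ler_expR mulr_ge0// addr_ge0//.
have Bmono s t : s <= t -> B s <= B t.
  by move=> st; rewrite ler_wpM2l// ler_expR ler_wpM2l// addr_ge0.
pose S := [set s | [/\ 0 <= s, s <= T & phi s <= B s]].
have S0 : S 0 by split=> //; rewrite /B mulr0 expR0 mulr1.
have ubS : ubound S T by move=> s [].
have hasS : has_sup S by split; [exists 0|exists T].
set s0 := sup S.
have s00 : 0 <= s0 by apply: ub_le_sup => //; exists T.
have s0T : s0 <= T by apply: ge_sup => //; exists 0.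
have phis0 : phi s0 <= B s0.
  apply/ler_addgt0Pr => e e0.
  have [d d0 phide] := phic _ s00 _ e0.
  have [s [sg0 sT Ss] ds] := sup_adherent d0 hasS.
  have ss0 : s <= s0 by apply: ub_le_sup => //; exists T.
  have := phide s sg0; rewrite distrC ger0_norm ?subr_ge0//.
  rewrite ltrBlDr -ltrBlDl => /(_ ds); rewrite ler_norml => /andP[+ _].
  have := Bmono _ _ ss0; lra.
have [<-//|s0nT] := eqVneq s0 T.
have {s0nT}s0T' : s0 < T by rewrite lt_neqAle s0nT.
have [d d0 phide] := phid _ s00 (A - c) (ltac:(by rewrite subr_gt0)).
(* A step that is short enough for the inequality and stays within [0,T]. *)
pose h := Num.min (d / 2) (T - s0).
have h0 : 0 < h by rewrite lt_min divr_gt0//= subr_gt0.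
have hd : h < d by rewrite gt_min ltr_pdivrMr// ltr_pMr// ltr1n.
have hT : s0 + h <= T by rewrite -lerBrDl ge_min lexx orbT.
suff : S (s0 + h).
  move/(ub_le_sup (ex_intro _ T ubS)); rewrite -/s0 => hs; exfalso; lra.
split => //; first lra.
apply: (le_trans (phide _ h0 hd)).
have expE : B (s0 + h) = B s0 * expR ((L + 1) * h).
  by rewrite /B mulrDr expRD mulrA.
have B0 : 0 <= B s0 by rewrite mulr_ge0// expR_ge0.
rewrite expE; apply: le_trans (_ : B s0 * (1 + (L + 1) * h) <= _); last first.
  by rewrite ler_wpM2l// expR_ge1Dx.
have -> : phi s0 + h * (L * phi s0 + c + (A - c)) = phi s0 + h * (L * phi s0 + A).
  by ring.
have -> : B s0 * (1 + (L + 1) * h) = B s0 + h * (L * B s0 + B s0) by ring.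
rewrite lerD// ler_wpM2l ?(ltW h0)// lerD ?BA//.
by rewrite ler_wpM2l.
Qed.

End Gronwall.

Section L2derivative.
Context (R : realType).

Lemma incrementsP (t : R) (P : R -> Prop) : (\forall h \near increments t, P h) ->
  exists2 d, 0 < d & forall h, `|h| < d -> h != 0 -> 0 <= t + h -> P h.
Proof.
move=> /nbhs_ballP[d /= d0 dP]; exists d => // h hd h0 th.
by apply: dP => //; rewrite /ball/= sub0r normrN.
Qed.

Context (E E' : R -> R -> R).
Hypothesis LE : forall t : R, 0 <= t -> inL2 (E t).
Hypothesis LE' : forall t : R, 0 <= t -> inL2 (E' t).
Hypothesis dE : forall t : R, 0 <= t ->
  L2norm (h^-1 *: (E (t + h) - E t) - E' t) @[h --> increments t] --> 0%E.

(** Differentiability in L^2 as a first-order expansion; multiplying by h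
    removes the quotient and so also covers h = 0. *)
Lemma L2_increment (t e : R) : 0 <= t -> 0 < e -> exists2 d, 0 < d &
  forall h, `|h| < d -> 0 <= t + h ->
  nrm (E (t + h) - E t - h *: E' t) <= e * `|h|.
Proof.
move=> t0 e0.
have : \forall h \near increments t,
    (L2norm (h^-1 *: (E (t + h) - E t) - E' t)%R < e%:E)%E.
  have H : nbhs 0%E [set z | (z < e%:E)%E].
    by apply: open_nbhs_nbhs; split; [exact: open_ereal_lt_ereal|rewrite /= lte_fin].
  exact: (dE t0 H).
move=> /incrementsP[d d0 dP]; exists d => // h hd th.
have [->|h0] := eqVneq h 0.
  rewrite addr0 subrr scale0r subrr normr0 mulr0.
  by rewrite (_ : 0 = cst 0)// nrm_cst normr0.
have Lq : inL2 (h^-1 *: (E (t + h) - E t) - E' t).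
  by apply: inL2B (LE' t0); apply/inL2Z/inL2B; exact: LE.
rewrite (_ : _ - _ = h *: (h^-1 *: (E (t + h) - E t) - E' t)); last first.
  by rewrite scalerBr scalerA mulfV// scale1r.
rewrite nrmZ// mulrC ler_wpM2r//.
by have := dP _ hd h0 th; rewrite nrmE// lte_fin => /ltW.
Qed.

(** The norm need not be differentiable where it vanishes, but its increments
    are always controlled by the norm of the derivative. *)
Lemma nrm_increment (t e : R) : 0 <= t -> 0 < e -> exists2 d, 0 < d &
  forall h, `|h| < d -> 0 <= t + h ->
  `|nrm (E (t + h)) - nrm (E t)| <= `|h| * (nrm (E' t) + e).
Proof.
move=> t0 e0; have [d d0 dP] := L2_increment t0 e0; exists d => // h hd th.
have LEh := LE th; have LEt := LE t0; have LE't := LE' t0.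
have LB := inL2B LEh LEt.
have H : nrm (E (t + h) - E t) <= `|h| * (nrm (E' t) + e).
  rewrite -[X in nrm X](subrK (h *: E' t)).
  apply: (le_trans (nrmD _ _)); [by apply: inL2B => //; exact: inL2Z|exact: inL2Z|].
  rewrite nrmZ// addrC mulrDr lerD// mulrC; exact: dP.
have H1 : nrm (E (t + h)) <= nrm (E (t + h) - E t) + nrm (E t).
  by rewrite -{1}[E (t + h)](subrK (E t)); exact: nrmD.
have H2 : nrm (E t) <= nrm (E (t + h) - E t) + nrm (E (t + h)).
  rewrite nrm_distC// -{1}[E t](subrK (E (t + h))).
  by apply: nrmD => //; exact: inL2B.
rewrite ler_norml; apply/andP; split; lra.
Qed.

Lemma nrm_continuous (t e : R) : 0 <= t -> 0 < e -> exists2 d, 0 < d &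
  forall s, 0 <= s -> `|s - t| < d -> `|nrm (E s) - nrm (E t)| <= e.
Proof.
move=> t0 e0; have [d d0 dP] := nrm_increment t0 ltr01.
have n1 : 0 < nrm (E' t) + 1 by rewrite ltr_wpDl// nrm_ge0.
(* The bound nrm (E' t) + 1 serves as a local Lipschitz constant. *)
exists (Num.min d (e / (nrm (E' t) + 1))).
  by rewrite lt_min d0 divr_gt0.
move=> s s0; rewrite lt_min => /andP[sd se].
have := dP (s - t) sd; rewrite addrC subrK => /(_ s0)/le_trans; apply.
by rewrite -ler_pdivlMr// ltW.
Qed.

Lemma nrm_within_continuous (T : R) :
  {within `[0, T], continuous (fun t => nrm (E t))}.
Proof.
apply/subspace_continuousP => t /=; rewrite in_itv/= => /andP[t0 _].
apply/cvgrPdist_le => e e0.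
have [d d0 dP] := nrm_continuous t0 e0.
apply/nbhs_ballP; exists d => //= s; rewrite /ball/= distrC => sd.
by rewrite in_itv/= => /andP[s0 _]; rewrite distrC dP.
Qed.

End L2derivative.

(** * Cells and step functions *)

Section Cells.
Context (R : realType) (N : nat).
Implicit Types (i j : 'I_N) (y : R) (v w : 'rV[R]_N).

Local Notation mu := (@lebesgue_measure R).

Let NR0 i : 0 < N%:R :> R.
Proof. by rewrite ltr0n (leq_ltn_trans (leq0n i) (ltn_ord i)). Qed.

Lemma cellP i y : @cell R N i y <->
  i%:R / N%:R <= y /\ (if i.+1 == N then y <= 1 else y < i.+1%:R / N%:R).
Proof.
rewrite /cell; case: ifP => _; rewrite /= in_itv/=; split.
- by move=> /andP[].
- by move=> [-> ->].
- by move=> /andP[].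
- by move=> [-> ->].
Qed.

Lemma cell_bounds i y : cell i y -> i%:R / N%:R <= y <= i.+1%:R / N%:R.
Proof.
have N0 := NR0 i; move=> /cellP[-> /=]; case: ifP => [/eqP ->|_ /ltW//].
by rewrite divff ?gt_eqF.
Qed.

Lemma cell_unitI i : cell i `<=` @unitI R.
Proof.
have N0 := NR0 i; move=> y /cell_bounds/andP[iy yi]; rewrite /unitI/= in_itv/=.
rewrite (le_trans _ iy) ?divr_ge0//= (le_trans yi)//.
by rewrite ler_pdivrMr// mul1r ler_nat.
Qed.

Lemma cell_inj i j y : cell i y -> cell j y -> i = j.
Proof.
have le_cell (k l : 'I_N) : cell k y -> cell l y -> (k <= l)%N.
  have N0 := NR0 k; move=> /cellP[ky _] /cellP[_ yl].
  have [lN|lN] := eqVneq l.+1 N.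
    by rewrite -ltnS lN.
  move: yl; rewrite (negbTE lN) => yl.
  have := le_lt_trans ky yl; rewrite ltr_pM2r ?invr_gt0// ltr_nat ltnS.
  exact.
by move=> iy jy; apply/val_inj/eqP; rewrite eqn_leq !le_cell.
Qed.

(** The index is the integer part of N y, except on the last cell, which is
    closed: at y = 1 the integer part is N. *)
Lemma cell_cover y : (0 < N)%N -> unitI y -> exists i, cell i y.
Proof.
move=> N0; have NR : 0 < N%:R :> R by rewrite ltr0n.
rewrite /unitI/= in_itv/= => /andP[y0 y1].
have [NN|yN] := leP N%:R (N%:R * y + 1).
  have lN : (N.-1 < N)%N by rewrite prednK.
  exists (Ordinal lN); apply/cellP; rewrite /= prednK// eqxx; split => //.
  by rewrite ler_pdivrMr// mulrC -subn1 natrB// lerBlDr.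
have Ny0 : 0 <= N%:R * y by rewrite mulr_ge0// ltW.
have /andP[tl tu] := truncn_itv Ny0.
set k := Num.truncn (N%:R * y) in tl tu.
have kN : (k.+1 < N)%N.
  by rewrite -(ltr_nat R) (le_lt_trans _ yN)// -natr1 lerD2r.
exists (Ordinal (ltnW kN)); apply/cellP => /=; rewrite ltn_eqF//; split.
  by rewrite ler_pdivrMr// mulrC.
by rewrite ltr_pdivlMr// mulrC.
Qed.

Lemma cell_dist i y y' : cell i y -> cell i y' -> `|y - y'| <= N%:R^-1.
Proof.
move=> /cell_bounds/andP[l u] /cell_bounds/andP[l' u'].
have E : i.+1%:R / N%:R = i%:R / N%:R + N%:R^-1 :> R.
  by rewrite -natr1 mulrDl div1r.
rewrite E in u u'; rewrite ler_norml; apply/andP; split; lra.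
Qed.

Lemma measurable_cell i : measurable (@cell R N i).
Proof. by rewrite /cell; case: ifP => _; exact: measurable_itv. Qed.

Lemma lebesgue_cell i : mu (@cell R N i) = (N%:R^-1)%:E.
Proof.
have N0 := NR0 i.
have lt_end : i%:R / N%:R < i.+1%:R / N%:R :> R.
  by rewrite ltr_pM2r ?invr_gt0// ltr_nat.
rewrite /cell; case: ifP => [/eqP iN|_].
  have E1 : i.+1%:R / N%:R = 1 :> R by rewrite iN divff ?gt_eqF.
  rewrite -[X in `[_, X]%classic]E1 lebesgue_measure_itv/= lte_fin lt_end.
  by rewrite -EFinD -mulrBl -natrB// subSnn mul1r.
rewrite lebesgue_measure_itv/= lte_fin lt_end -EFinD -mulrBl -natrB//.
by rewrite subSnn mul1r.
Qed.

Lemma step_cell v i y : cell i y -> step v y = v 0 i.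
Proof.
move=> iy; rewrite /step (bigD1 i)//= indicE mem_set// mulr1.
rewrite big1 ?addr0// => j ji; rewrite indicE memNset ?mulr0// => jy.
by move/eqP: ji; apply; exact: cell_inj jy iy.
Qed.

Lemma measurable_step v : measurable_fun setT (step v).
Proof.
apply: measurable_sum => i; apply: measurable_funM => //.
apply: measurable_indic; exact: measurable_cell.
Qed.

Lemma stepB v w : step (v - w) = step v - step w.
Proof.
apply/funext => y; rewrite /step !fctE -sumrB; apply: eq_bigr => i _.
by rewrite !mxE mulrBl.
Qed.

Lemma stepZ c v : step (c *: v) = c *: step v.
Proof.
apply/funext => y; rewrite /step -[RHS]/(c * _) mulr_sumr.
by apply: eq_bigr => i _; rewrite !mxE mulrA.
Qed.

Lemma step_bound v (C : R) y : 0 <= C -> (forall i, `|v 0 i| <= C) ->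
  `|step v y| <= C.
Proof.
move=> C0 vC; have [[i iy]|niy] := pselect (exists i, cell i y).
  by rewrite (step_cell _ iy).
rewrite /step big1 ?normr0// => i _; rewrite indicE memNset ?mulr0// => iy.
by apply: niy; exists i.
Qed.

Lemma inL2_step v : inL2 (step v).
Proof.
have C0 : 0 <= \sum_i `|v 0 i| by apply: sumr_ge0.
apply: (inL2_le (measurable_step v) (inL2_cst (\sum_i `|v 0 i|))).
apply: aeI => y _; rewrite [leRHS]ger0_norm//; apply: step_bound => // i.
by rewrite (bigD1 i)//= lerDl sumr_ge0.
Qed.

(** The norm on row vectors is the maximum norm and I has measure 1. *)
Lemma nrm_step_le v : nrm (step v) <= `|v|.
Proof.
rewrite -[leRHS]ger0_norm// -(nrm_cst `|v|).
apply: nrm_le; [exact: measurable_step|exact: inL2_cst|].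
apply: aeI => y _; rewrite [leRHS]ger0_norm//; apply: step_bound => // i.
rewrite [leRHS]/Num.norm/= mx_normrE.
exact: (le_bigmax _ (fun k => `|v k.1 k.2|) (ord0, i)).
Qed.

(** All cells have measure 1/N: this turns the mean-field sum of the network
    into an integral. *)
Lemma Rintegral_step v :
  \int[mu]_(y in @unitI R) step v y = N%:R^-1 * \sum_i v 0 i.
Proof.
rewrite /Rintegral.
have -> : (\int[mu]_(y in @unitI R) (step v y)%:E =
    \int[mu]_(y in @unitI R) \sum_(i < N) (v 0 i * \1_(cell i) y)%:E)%E.
  by apply: eq_integral => y _; rewrite sumEFin.
have mI := @measurable_unitI R.
have int1 i : mu.-integrable (@unitI R) (fun y => (\1_(cell i) y)%:E).
  apply: (@integrable_unitI_bounded _ \1_(cell i) 1).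
    by apply: measurable_funTS; apply: measurable_indic; exact: measurable_cell.
  by move=> y _; rewrite indicE ger0_norm// lern1 leq_b1.
rewrite integral_sum//; last first.
  by move=> i; under eq_fun do rewrite EFinM; exact: integrableZl.
have -> : (\sum_(i < N) \int[mu]_(y in @unitI R) (v 0 i * \1_(cell i) y)%:E
    = \sum_(i < N) (v 0 i * N%:R^-1)%:E)%E.
  apply: eq_bigr => i _; under eq_integral do rewrite EFinM.
  rewrite integralZl// integral_indic//; last exact: measurable_cell.
  rewrite setIidl; last exact: cell_unitI.
  by rewrite [X in (_ * X)%E]lebesgue_cell EFinM.
by rewrite sumEFin/= mulr_sumr; apply: eq_bigr => i _; rewrite mulrC.
Qed.

End Cells.

(** * Averaged kernels *)

Section Kernels.
Context (R : realType).
Implicit Types (W : R * R -> R).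

Local Notation mu := (@lebesgue_measure R).
Local Notation mu2 := (mu \x mu)%E.

Lemma measurable_sqI : measurable (@sqI R).
Proof. by apply: measurableX; exact: measurable_unitI. Qed.

Lemma lebesgue_sqI : mu2 (@sqI R) = 1%:E.
Proof.
have mI := @measurable_unitI R.
rewrite /sqI [LHS]product_measure1E//.
by rewrite [X in (X * _)%E]lebesgue_unitI [X in (_ * X)%E]lebesgue_unitI mule1.
Qed.

Lemma lebesgue_cellX N (i j : 'I_N) :
  mu2 (@cell R N i `*` @cell R N j) = (N%:R ^- 2)%:E.
Proof.
rewrite [LHS]product_measure1E; [|exact: measurable_cell..].
rewrite [X in (X * _)%E]lebesgue_cell [X in (_ * X)%E]lebesgue_cell.
by rewrite -EFinM -invfM expr2.
Qed.

Lemma cellX_sqI N (i j : 'I_N) : @cell R N i `*` @cell R N j `<=` @sqI R.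
Proof. by move=> [y y'] [/= /cell_unitI ? /cell_unitI ?]. Qed.

(** The difference is the average of W - c over a rectangle of measure N^-2. *)
Lemma WN_close W N (i j : 'I_N) (c e : R) : measurable_fun (@sqI R) W ->
  (forall p, (cell i `*` cell j) p -> `|W p - c| <= e) ->
  `|WN W N i j - c| <= e.
Proof.
move=> mW Wc; pose D := @cell R N i `*` @cell R N j.
have mD : @measurable _ (measurableTypeR R * measurableTypeR R)%type D.
  by apply: measurableX; exact: measurable_cell.
have N0 : 0 < N%:R :> R by rewrite ltr0n (leq_ltn_trans (leq0n i) (ltn_ord i)).
have muD : fine (mu2 D) = N%:R ^- 2 by rewrite [X in fine X]lebesgue_cellX.
have Dfin : (mu2 D < +oo)%E by rewrite [ltLHS]lebesgue_cellX ltry.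
have bounded_int (h : R * R -> R) C : measurable_fun D h ->
    (forall p, D p -> `|h p| <= C) -> mu2.-integrable D (EFin \o h).
  move=> mh hC; apply: measurable_bounded_integrable => //.
  exists C; split; first exact: num_real.
  by move=> M CM p Dp; apply: (le_trans (hC _ Dp)); exact: ltW.
have mWD : measurable_fun D W.
  by apply: measurable_funS mW; [exact: measurable_sqI|exact: cellX_sqI].
have mWc : measurable_fun D (fun p => W p - c) by exact: measurable_funB.
have iWc := bounded_int _ _ mWc Wc.
have icst k : mu2.-integrable D (EFin \o cst k).
  by apply: (bounded_int _ `|k|).
have iW : mu2.-integrable D (EFin \o W).
  apply: (bounded_int _ (e + `|c|)) => // p Dp.
  by rewrite -[W p](subrK c) (le_trans (ler_normD _ _))// lerD2r Wc.
have cE : \int[mu2]_(p in D) c = c * N%:R ^- 2 by rewrite Rintegral_cst// muD.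
have -> : WN W N i j - c = N%:R ^+ 2 * \int[mu2]_(p in D) (W p - c).
  rewrite mxE RintegralB//; last exact: icst.
  by rewrite cE mulrBr mulrCA mulfV ?mulr1// expf_neq0// gt_eqF.
rewrite normrM ger0_norm ?exprn_ge0//.
have -> : e = N%:R ^+ 2 * (e * N%:R ^- 2).
  by rewrite mulrCA mulfV ?mulr1// expf_neq0// gt_eqF.
rewrite ler_wpM2l ?exprn_ge0//.
apply: (le_trans (le_normr_Rintegral mD iWc)).
rewrite -muD -Rintegral_cst//; apply: le_Rintegral => //; last exact: icst.
exact: integrable_norm.
Qed.

(** The kernel on I^2 with value A i j on cell i x cell j, written as a step
    function in the second variable whose coefficients are step functions in
    the first, so that the facts on step apply twice. *)
Definition step_kernel N (A : 'M[R]_N) (p : R * R) : R :=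
  step (\row_j step (\row_i A i j) p.1) p.2.

Lemma step_kernel_cell N (A : 'M[R]_N) i j y y' :
  cell i y -> cell j y' -> step_kernel A (y, y') = A i j.
Proof.
by move=> iy jy'; rewrite /step_kernel (step_cell _ jy') mxE (step_cell _ iy) mxE.
Qed.

Lemma measurable_step_kernel N (A : 'M[R]_N) :
  measurable_fun setT (step_kernel A).
Proof.
rewrite /step_kernel /(step (\row__ _) _).
apply: measurable_sum => j; apply: measurable_funM.
  under eq_fun do rewrite mxE.
  by apply: measurableT_comp; [exact: measurable_step|exact: measurable_fst].
have mj : measurable_fun setT (\1_(@cell R N j) : R -> R).
  by apply: measurable_indic; exact: measurable_cell.
exact: (measurableT_comp mj measurable_snd).
Qed.

Lemma step_kernel_bound N (A : 'M[R]_N) (C : R) p : 0 <= C ->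
  (forall i j, `|A i j| <= C) -> `|step_kernel A p| <= C.
Proof.
move=> C0 AC; apply: step_bound => // j; rewrite mxE.
by apply: step_bound => // i; rewrite mxE.
Qed.

Lemma graphon_bound W p : graphon W -> sqI p -> `|W p| <= 1.
Proof.
case: p => y y' [_ _ W01] [/= Iy Iy'].
by have /andP[W0 W1] := W01 _ _ Iy Iy'; rewrite ger0_norm.
Qed.

Lemma WN_bound W N (i j : 'I_N) : graphon W -> `|WN W N i j| <= 1.
Proof.
move=> gW; rewrite -[WN _ _ _ _]subr0; apply: WN_close; first by case: gW.
by move=> p /cellX_sqI; rewrite subr0; exact: graphon_bound.
Qed.

(** The cells that contain p shrink to p, so that by continuity W is eventually
    close to W p on the whole rectangle over which it is averaged. *)
Lemma step_kernel_WN_cvg W p : graphon W -> sqI p ->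
  W q @[q --> within (@sqI R) (nbhs p)] --> W p ->
  step_kernel (WN W N) p @[N --> \oo] --> W p.
Proof.
case: p => y y' gW [/= Iy Iy'] cW; apply/cvgrPdist_le => e e0.
have : \forall q \near within (@sqI R) (nbhs (y, y')), `|W (y, y') - W q| <= e.
  by move/cvgrPdist_le : cW; exact.
move=> /nbhs_ballP[d /= d0 dP].
near=> N.
have N0 : (0 < N)%N by near: N; exact: nbhs_infty_gt.
have [i iy] := cell_cover N0 Iy; have [j jy'] := cell_cover N0 Iy'.
have Nd : N%:R^-1 < d.
  rewrite invf_plt ?posrE ?ltr0n//; near: N; exact: nbhs_infty_gtr.
rewrite (step_kernel_cell _ iy jy') distrC; apply: WN_close.
  by case: gW.
move=> [z z'] [/= iz jz']; rewrite distrC; apply: dP.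
  split => /=; apply: le_lt_trans Nd.
    exact: cell_dist iy iz.
  exact: cell_dist jy' jz'.
by split => /=; [exact: cell_unitI iz|exact: cell_unitI jz'].
Unshelve. all: by end_near. Qed.

Lemma step_kernel_WN_L1 W : graphon W -> ae_continuous W ->
  (\int[mu2]_(p in @sqI R) `|step_kernel (WN W N) p - W p|%:E)%E
    @[N --> \oo] --> 0%E.
Proof.
move=> gW cW.
have mI := measurable_sqI.
have [| | | | |_ + _] := @dominated_convergence _ _ R mu2 (@sqI R) mI
  (fun N p => (step_kernel (WN W N) p)%:E) (EFin \o W) (cst 1%E).
- move=> N; apply: measurable_funTS; apply: measurableT_comp => //.
  exact: measurable_step_kernel.
- by case: gW => mW _ _; apply: measurableT_comp.
- move: cW; apply: filterS; first exact: (ae_filter_ringOfSetsType mu2).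
  move=> p cWp Ip; apply: cvg_EFin; first by apply: nearW.
  by apply: step_kernel_WN_cvg => //; exact: cWp.
- apply: (@measurable_bounded_integrable _ _ _ mu2 (cst 1)) => //.
    by rewrite [ltLHS]lebesgue_sqI ltry.
  exists 1; split; [exact: num_real|move=> M M1 p _].
  by rewrite /= normr1 ltW.
- apply: (@filterE _ _ (ae_filter_ringOfSetsType mu2)).
  move=> p N Ip; rewrite lee_fin; apply: step_kernel_bound => // i j.
  exact: WN_bound.
by [].
Qed.

(** The network vector field, seen as a step function, is the graphon vector
    field of the averaged kernel: the integrand is itself a step function of
    the integration variable. *)
Lemma step_network_rhs (f : R -> R) (G : R -> R -> R) W N (v : 'rV[R]_N) y :
  (0 < N)%N -> unitI y ->
  step (network_rhs f G W v) y =
  graphon_rhs f G (step_kernel (WN W N)) (step v) y.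
Proof.
move=> N0 Iy; have [i iy] := cell_cover N0 Iy.
rewrite (step_cell _ iy) mxE /graphon_rhs (step_cell _ iy); congr (_ + _).
pose w : 'rV[R]_N := \row_j (WN W N i j * G (v 0 i) (v 0 j)).
have -> : \int[mu]_(y' in @unitI R)
    (step_kernel (WN W N) (y, y') * G (v 0 i) (step v y')) =
    \int[mu]_(y' in @unitI R) step w y'.
  apply: eq_Rintegral => y'; rewrite inE => Iy'.
  have [j jy'] := cell_cover N0 Iy'.
  by rewrite (step_kernel_cell _ iy jy') !(step_cell _ jy') [w 0 j]mxE.
rewrite [RHS](Rintegral_step w); congr (_ * _).
by apply: eq_bigr => j _; rewrite [w 0 j]mxE.
Qed.

End Kernels.

(** * Dependence of the right-hand side on state and kernel *)

Section Stability.
Context (R : realType).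
Implicit Types (W V k : R * R -> R) (u v : R -> R).

Local Notation mu := (@lebesgue_measure R).
Local Notation mu2 := (mu \x mu)%E.

Lemma measurable_slice k y : measurable_fun (@sqI R) k -> unitI y ->
  measurable_fun (@unitI R) (fun y' => k (y, y')).
Proof.
move=> mk Iy.
have mk' : measurable_fun setT (k \_ (@sqI R)).
  exact: (measurable_restrictT _ (@measurable_sqI R)).1 mk.
have := measurableT_comp mk' (measurable_pair1 y).
move/(@measurable_funTS _ _ _ _ (@unitI R)); apply: eq_measurable_fun => y'.
by rewrite inE => Iy' /=; rewrite patchT// inE.
Qed.

(** The row integrals d of a kernel with values in [0,B] are bounded by B, so
    that d^2 <= B d, and the integral of d is the double integral of k by
    Tonelli. Thus smallness in L^1(I^2) gives smallness of d in L^2(I). *)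
Lemma kernel_slice_norm k (B : R) : measurable_fun (@sqI R) k ->
  (forall p, sqI p -> 0 <= k p <= B) ->
  exists d : R -> R, [/\ inL2 d,
    forall y, 0 <= d y,
    forall y, unitI y -> d y = \int[mu]_(y' in @unitI R) k (y, y') &
    nrm d <= Num.sqrt (B * fine (\int[mu2]_(p in @sqI R) (k p)%:E)%E)].
Proof.
move=> mk kB.
have mk' : measurable_fun setT (k \_ (@sqI R)).
  exact: (measurable_restrictT _ (@measurable_sqI R)).1 mk.
pose K p := ((k \_ (@sqI R)) p)%:E.
have mK : measurable_fun setT K by exact: measurableT_comp.
have K0 p : (0 <= K p)%E.
  rewrite /K lee_fin /patch; case: ifP => //; rewrite inE => Ip.
  by have /andP[] := kB _ Ip.
pose F := fubini_F mu K.
have mF : measurable_fun setT F by exact: measurable_fun_fubini_tonelli_F.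
have F0 y : (0 <= F y)%E by apply: integral_ge0.
have B0 : 0 <= B.
  have I0 : unitI (0 : R) by rewrite /unitI/= in_itv/= lexx ler01.
  by have /andP[k0 /(le_trans k0)] := kB (0, 0) (conj I0 I0).
have FI y : unitI y -> F y = (\int[mu]_(y' in @unitI R) (k (y, y'))%:E)%E.
  move=> Iy; rewrite /F /fubini_F [RHS]integral_mkcond.
  apply: eq_integral => y' _; rewrite /K /patch.
  have -> : ((y, y') \in @sqI R) = (y' \in @unitI R).
    by apply/idP/idP; rewrite !inE; [case|].
  by case: ifP.
have FnI y : ~ unitI y -> F y = 0%E.
  move=> nIy; rewrite /F /fubini_F integral0_eq// => y' _.
  by rewrite /K patchN// notin_setE => -[].
have FB y : (F y <= B%:E)%E.
  have [Iy|nIy] := pselect (unitI y); last by rewrite FnI.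
  rewrite FI// -[leRHS]mule1 -lebesgue_unitI -integral_cst; last first.
    exact: measurable_unitI.
  apply: ge0_le_integral => //.
  - exact: measurable_unitI.
  - by move=> y' Iy'; rewrite lee_fin; have /andP[] := kB (y, y') (conj Iy Iy').
  - by apply: measurableT_comp => //; exact: measurable_slice.
  - by move=> y' Iy'; rewrite lee_fin; have /andP[] := kB (y, y') (conj Iy Iy').
pose d y := fine (F y).
have dE y : (d y)%:E = F y.
  by rewrite /d fineK// ge0_fin_numE// (le_lt_trans (FB y))// ltry.
have d0 y : 0 <= d y by rewrite -lee_fin dE.
have dB y : d y <= B by rewrite -lee_fin dE.
have md : measurable_fun setT d.
  by apply: measurableT_comp => //; exact: measurable_fine.
have Ld : inL2 d.
  apply: (inL2_le md (inL2_cst B)); apply: aeI => y _.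
  by rewrite !ger0_norm.
exists d; split => //.
  by move=> y Iy; rewrite /d FI.
have intk : (\int[mu2]_(p in @sqI R) (k p)%:E)%E =
    (\int[mu]_(y in @unitI R) (d y)%:E)%E.
  rewrite integral_mkcond [RHS]integral_mkcond.
  transitivity (\int[mu]_y F y)%E.
    rewrite -fubini_tonelli1//; apply: eq_integral => p _.
    by rewrite /K /patch; case: ifP.
  apply: eq_integral => y _; rewrite /patch; case: ifPn => //.
  by rewrite notin_setE => /FnI.
have dfin : (\int[mu]_(y in @unitI R) (d y)%:E)%E \is a fin_num.
  apply: integrable_fin_num; first exact: measurable_unitI.
  exact: integrable_unitI.
have d2 : nrm d ^+ 2 <= B * fine (\int[mu2]_(p in @sqI R) (k p)%:E)%E.
  rewrite intk -lee_fin [leRHS]EFinM fineK//.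
  have := L2norm_sqr d; rewrite nrmE// poweR_EFin powR_mulrn ?nrm_ge0// => ->.
  rewrite -ge0_integralZl//.
  - apply: ge0_le_integral => //.
    + exact: measurable_unitI.
    + by move=> y _; rewrite lee_fin sqr_ge0.
    + apply: measurableT_comp => //; apply: measurable_funX.
      exact: measurable_funTS.
    + apply: measurable_funeM; apply: measurableT_comp => //.
      exact: measurable_funTS.
    + by move=> y _; rewrite -EFinM lee_fin expr2 ler_wpM2r.
  - exact: measurable_unitI.
  - by apply: measurableT_comp => //; exact: measurable_funTS.
  - by move=> y _; rewrite lee_fin.
by rewrite -[leLHS]ger0_norm ?nrm_ge0// -sqrtr_sqr ler_wsqrtr.
Qed.

Lemma lipschitz_measurable (g : R -> R) (L : R) :
  (forall a b : R, `|g a - g b| <= L * `|a - b|) -> measurable_fun setT g.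
Proof.
move=> gL; apply: continuous_measurable_fun => x.
apply/cvgrPdist_le => e e0.
have L1 : 0 < `|L| + 1 by rewrite ltr_wpDl.
apply/nbhs_ballP; exists (e / (`|L| + 1)) => /=; first by rewrite divr_gt0.
move=> z; rewrite /ball/= => xz; apply: (le_trans (gL _ _)).
apply: (@le_trans _ _ ((`|L| + 1) * `|x - z|)).
  by rewrite ler_wpM2r// (le_trans (ler_norm _))// lerDl.
by rewrite mulrC -ler_pdivlMr// ltW.
Qed.

Context (f : R -> R) (G : R -> R -> R) (K L C : R).
Hypotheses (K0 : 0 <= K) (L0 : 0 <= L) (C0 : 0 <= C).
Hypothesis fK : forall a b : R, `|f a - f b| <= K * `|a - b|.
Hypothesis GL : forall a b a' b' : R,
  `|G a b - G a' b'| <= L * (`|a - a'| + `|b - b'|).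
Hypothesis GC : forall a b : R, `|G a b| <= C.

Lemma integrable_interaction V u (r y : R) : measurable_fun (@sqI R) V ->
  (forall p, sqI p -> `|V p| <= 1) -> measurable_fun setT u -> unitI y ->
  mu.-integrable (@unitI R) (EFin \o (fun y' => V (y, y') * G r (u y'))).
Proof.
move=> mV V1 mu_ Iy; apply: (@integrable_unitI_bounded _ _ C).
  apply: measurable_funM; first exact: measurable_slice.
  apply: measurable_funTS; apply: (@measurableT_comp _ _ _ _ _ _ (G r)) => //.
  apply: (@lipschitz_measurable _ L) => a b; apply: (le_trans (GL _ _ _ _)).
  by rewrite subrr normr0 add0r.
move=> y' Iy'; rewrite normrM -[leRHS]mul1r ler_pM//.
by apply: V1.
Qed.

(** Split V G(u,u') - W G(v,v') as V (G(u,u') - G(v,v')) + (V - W) G(v,v'). *)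
Lemma graphon_rhs_dist V W u v y : measurable_fun (@sqI R) V ->
  measurable_fun (@sqI R) W ->
  (forall p, sqI p -> `|V p| <= 1) -> (forall p, sqI p -> `|W p| <= 1) ->
  inL2 u -> inL2 v -> unitI y ->
  `|graphon_rhs f G V u y - graphon_rhs f G W v y| <=
  (K + L) * `|u y - v y| + L * nrm (u - v) +
    C * \int[mu]_(y' in @unitI R) `|V (y, y') - W (y, y')|.
Proof.
move=> mV mW V1 W1 Lu Lv Iy.
have mI : @measurable _ (measurableTypeR R) (@unitI R) := @measurable_unitI R.
have iV := integrable_interaction (u y) mV V1 (inL2_measurable Lu) Iy.
have iW := integrable_interaction (v y) mW W1 (inL2_measurable Lv) Iy.
rewrite /graphon_rhs opprD addrACA (le_trans (ler_normD _ _))//.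
rewrite mulrDl -!addrA lerD ?fK//.
rewrite -RintegralB//.
have iuv : mu.-integrable (@unitI R) (EFin \o (fun y' => `|u y' - v y'|)).
  exact/integrable_norm/integrable_unitI/inL2B.
have iVW : mu.-integrable (@unitI R)
    (EFin \o (fun y' => `|V (y, y') - W (y, y')|)).
  apply: (@integrable_unitI_bounded _ _ (1 + 1)).
    apply: measurableT_comp => //; apply: measurable_funB; exact: measurable_slice.
  move=> y' Iy'; rewrite normr_id (le_trans (ler_normB _ _))//.
  by rewrite lerD ?V1 ?W1.
have icst (c : R) : mu.-integrable (@unitI R) (EFin \o cst c).
  exact/integrable_unitI/inL2_cst.
have iVWG := integrableB mI iV iW.
have iL := integrableZl mI L iuv.
have iC := integrableZl mI C iVW.
have iR := integrableD mI iL iC.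
apply: (@le_trans _ _ (\int[mu]_(y' in @unitI R)
   (L * `|u y - v y| + (L * `|u y' - v y'| + C * `|V (y, y') - W (y, y')|)))).
  apply: (le_trans (le_normr_Rintegral _ _)) => //.
  apply: le_Rintegral => //.
  - exact/integrable_norm/iVWG.
  - exact: (integrableD mI (icst _) iR).
  move=> y' Iy'.
  have -> : V (y, y') * G (u y) (u y') - W (y, y') * G (v y) (v y') =
     V (y, y') * (G (u y) (u y') - G (v y) (v y')) +
     (V (y, y') - W (y, y')) * G (v y) (v y') by ring.
  rewrite (le_trans (ler_normD _ _))// !normrM addrA -mulrDr lerD//.
    rewrite (le_trans _ (GL _ _ _ _))// -[leRHS]mul1r ler_wpM2r// V1//.
  by rewrite mulrC ler_wpM2r.
rewrite RintegralD//; last exact: icst.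
rewrite RintegralD//.
rewrite [X in X + _ <= _]Rintegral_cst// [X in fine X]lebesgue_unitI mulr1.
rewrite !RintegralZl// lerD2l lerD2r ler_wpM2l//.
exact/Rintegral_norm_le_nrm/inL2B.
Qed.

(** The pointwise bound is itself an L^2 function of y: the sum of a multiple of
    |u - v|, a constant and the row integrals of |V - W|. *)
Lemma graphon_rhs_nrm_dist V W u v (g : R -> R) : measurable_fun (@sqI R) V ->
  measurable_fun (@sqI R) W ->
  (forall p, sqI p -> `|V p| <= 1) -> (forall p, sqI p -> `|W p| <= 1) ->
  inL2 u -> inL2 v -> inL2 g ->
  {ae @lebI R, forall y, g y = graphon_rhs f G V u y - graphon_rhs f G W v y} ->
  nrm g <= (K + L + L) * nrm (u - v) + C * Num.sqrt
    (2 * fine (\int[mu2]_(p in @sqI R) `|V p - W p|%:E)%E).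
Proof.
move=> mV mW V1 W1 Lu Lv Lg gE.
have [||d [Ld d0 dE nd]] := @kernel_slice_norm (fun p => `|V p - W p|) 2.
- by apply: measurableT_comp => //; exact: measurable_funB.
- move=> p Ip; rewrite normr_ge0 (le_trans (ler_normB _ _))// (natrD _ 1 1).
  by rewrite lerD ?V1 ?W1.
pose w y := `|u y - v y|.
have Luv := inL2B Lu Lv.
have mw : measurable_fun setT w.
  by apply: measurableT_comp => //; exact: (inL2_measurable Luv).
have Lw : inL2 w.
  by apply: (inL2_le mw Luv); apply: aeI => y _; rewrite /w normr_id.
have nw : nrm w <= nrm (u - v).
  by apply: (nrm_le mw Luv); apply: aeI => y _; rewrite /w normr_id.
pose c : R -> R := cst (L * nrm (u - v)).
have Lc : inL2 c by exact: inL2_cst.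
have L1 := inL2Z (K + L) Lw; have L2 := inL2Z C Ld.
have nc : nrm c = L * nrm (u - v).
  by rewrite nrm_cst ger0_norm// mulr_ge0// nrm_ge0.
apply: (@le_trans _ _ (nrm ((K + L) *: w + c + C *: d))).
  apply: nrm_le; [exact: inL2_measurable|by apply: inL2D => //; exact: inL2D|].
  have : {ae @lebI R, forall y, unitI y} by apply: aeI.
  move=> /(ae_lebI_and gE); apply: ae_lebI_imply => y [-> Iy].
  apply: (le_trans (graphon_rhs_dist mV mW V1 W1 Lu Lv Iy)).
  by rewrite -dE// ler_norm.
apply: (le_trans (nrmD _ _)) => //; first exact: inL2D.
apply: lerD.
  apply: (le_trans (nrmD _ _)) => //.
  rewrite nc mulrDl lerD2r nrmZ// ger0_norm ?addr_ge0//.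
  by rewrite ler_wpM2l// addr_ge0.
by rewrite nrmZ// ger0_norm// ler_wpM2l.
Qed.

End Stability.

(** * Projection onto the phase space and the equation of the error *)

Section Clamp.
Context (R : realType) (a b : R) (hab : a <= b).

(** The nearest-point projection onto [a,b]. *)
Definition clamp (r : R) : R := Num.max a (Num.min b r).

Lemma clamp_itv r : clamp r \in `[a, b].
Proof. by rewrite in_itv/= le_max lexx/= ge_max hab ge_min lexx. Qed.

Lemma clamp_id r : r \in `[a, b] -> clamp r = r.
Proof.
by rewrite in_itv/= => /andP[ar rb]; rewrite /clamp min_r// max_r.
Qed.

Lemma clamp_dist r s : `|clamp r - clamp s| <= `|r - s|.
Proof.
have le_clamp p q : clamp p <= clamp q + `|p - q|.
  rewrite {1}/clamp ge_max; apply/andP; split.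
    by rewrite -[leLHS]addr0 lerD// le_max lexx.
  have [bq|qb] := leP b q.
    rewrite -[leLHS]addr0 lerD// (@le_trans _ _ b) ?ge_min ?lexx//.
    by rewrite /clamp min_l// le_max lexx orbT.
  apply: (@le_trans _ _ (q + `|p - q|)).
    by rewrite ge_min; apply/orP; right; rewrite -lerBlDl ler_norm.
  by rewrite lerD2r /clamp min_r ?(ltW qb)// le_max lexx orbT.
rewrite ler_norml lerBlDl le_clamp andbT lerNl opprB lerBlDl.
by rewrite distrC le_clamp.
Qed.

End Clamp.

Section ErrorEquation.
Context (R : realType).

Local Notation mu := (@lebesgue_measure R).

Lemma sqrt_sum_sqr_le (p q : R) : Num.sqrt (p ^+ 2 + q ^+ 2) <= `|p| + `|q|.
Proof.
have pq0 : 0 <= `|p| + `|q| by rewrite addr_ge0.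
rewrite -[leRHS]ger0_norm// -sqrtr_sqr ler_wsqrtr// sqrrD !real_normK ?num_real//.
by rewrite lerD2r lerDl mulrn_wge0// mulr_ge0.
Qed.

(** This is what allows f and G to be replaced by globally Lipschitz functions:
    the integrand changes on a null set only. *)
Lemma eq_graphon_rhs (Omega : set R) (f f' : R -> R) (G G' : R -> R -> R)
    (W : R * R -> R) (u : R -> R) (y : R) :
  (forall r, Omega r -> f r = f' r) ->
  (forall r s, Omega r -> Omega s -> G r s = G' r s) ->
  {ae @lebI R, forall z, Omega (u z)} -> Omega (u y) ->
  graphon_rhs f G W u y = graphon_rhs f' G' W u y.
Proof.
move=> ff' GG' [A [mA A0 uA]] uy; rewrite /graphon_rhs ff'//; congr (_ + fine _).
have mAI : measurable (A `&` @unitI R).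
  by apply: measurableI => //; exact: measurable_unitI.
apply: (integral_eq_off_null mAI A0) => y' Iy' nAy'.
rewrite GG'//; apply: contrapT => nu; apply: nAy'; split => //.
exact: uA.
Qed.

(** Convergence of difference quotients in R^N implies convergence of the step
    functions in L^2(I), because step is linear and does not increase norms. *)
Lemma step_network_derivative N (z z' : R -> 'rV[R]_N) (x x' : R -> R -> R) (t : R) :
  0 <= t -> (forall s, 0 <= s -> inL2 (x s)) -> inL2 (x' t) ->
  h^-1 *: (z (t + h) - z t) @[h --> increments t] --> z' t ->
  L2norm (h^-1 *: (x (t + h) - x t) - x' t) @[h --> increments t] --> 0%E ->
  L2norm (h^-1 *: ((step (z (t + h)) - x (t + h)) - (step (z t) - x t))
    - (step (z' t) - x' t)) @[h --> increments t] --> 0%E.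
Proof.
move=> t0 Lx Lx' dz dx.
pose q h := h^-1 *: (z (t + h) - z t) - z' t.
pose p h := h^-1 *: (x (t + h) - x t) - x' t.
have q0 : (`|q h|%:E)%E @[h --> increments t] --> 0%E.
  apply: cvg_EFin; first by apply: nearW.
  apply/norm_cvg0P; exact/subr_cvg0.
apply: (@squeeze_cvge _ _ _ _ (cst 0%E) _ (fun h => (`|q h|%:E + L2norm (p h))%E)).
- rewrite /increments /=.
  near=> h.
  have th : 0 <= t + h by near: h; exact: withinT.
  rewrite L2norm_ge0/=.
  have -> : h^-1 *: (step (z (t + h)) - x (t + h) - (step (z t) - x t)) -
      (step (z' t) - x' t) = step (q h) - p h.
    rewrite /q /p !stepB stepZ stepB.
    by apply/funext => y; rewrite !fctE /=; ring.
  have Lp : inL2 (p h).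
    by apply: inL2B => //; apply/inL2Z/inL2B; exact: Lx.
  have Lq := inL2_step (q h).
  rewrite !nrmE//; last exact: inL2B.
  rewrite -EFinD lee_fin (le_trans (nrmB Lq Lp))// lerD2r.
  exact: nrm_step_le.
- exact: cvg_cst.
- rewrite -(adde0 0%E); apply: cvgeD => //.
Unshelve. all: by end_near. Qed.

End ErrorEquation.

(** * Convergence *)

Section Convergence.
Context (R : realType).
Local Notation mu := (@lebesgue_measure R).
Local Notation mu2 := (mu \x mu)%E.

(** K collects the Lipschitz constants of f and G, and C bounds G on the square.
    That they do not depend on N or t makes the Gronwall bound uniform. *)
Lemma network_error_derivative (a b : R) (hab : a <= b)
    (f : R -> R) (Lf : R)
    (hf : forall u u', u \in `[a, b] -> u' \in `[a, b] ->
      `|f u - f u'| <= Lf * `|u - u'|)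
    (G : R -> R -> R) (LG : R)
    (hG : forall u v u' v', u \in `[a, b] -> v \in `[a, b] ->
      u' \in `[a, b] -> v' \in `[a, b] ->
      `|G u v - G u' v'| <= LG * Num.sqrt ((u - u') ^+ 2 + (v - v') ^+ 2)) :
  exists K C : R, [/\ 0 <= K, 0 <= C &
  forall (W : R * R -> R), graphon W ->
  forall (N : nat) (z : R -> 'rV[R]_N) (x : R -> R -> R), (0 < N)%N ->
  network_solution `[a, b] f G W z -> graphon_solution `[a, b] f G W x ->
  exists E' : R -> R -> R, [/\ forall t : R, 0 <= t -> inL2 (step (z t) - x t),
    forall t : R, 0 <= t -> inL2 (E' t),
    forall t : R, 0 <= t ->
      L2norm (h^-1 *: ((step (z (t + h)) - x (t + h)) - (step (z t) - x t)) - E' t)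
        @[h --> increments t] --> 0%E &
    forall t : R, 0 <= t -> nrm (E' t) <= K * nrm (step (z t) - x t) + C * Num.sqrt
      (2 * fine (\int[mu2]_(p in @sqI R) `|step_kernel (WN W N) p - W p|%:E)%E)]].
Proof.
pose ft r := f (clamp a b r).
pose Gt r s := G (clamp a b r) (clamp a b s).
pose K := `|Lf|; pose L := `|LG|.
(* By the Lipschitz bound from the corner (a,a) of the square. *)
pose C := `|G a a| + L * ((b - a) + (b - a)).
have K0 : 0 <= K by exact: normr_ge0.
have L0 : 0 <= L by exact: normr_ge0.
have cI := @clamp_itv _ _ _ hab.
have Gd r s r' s' : `|Gt r s - Gt r' s'| <=
    L * (`|clamp a b r - clamp a b r'| + `|clamp a b s - clamp a b s'|).
  rewrite (le_trans (hG _ _ _ _ _ _ _ _))//.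
  apply: (@le_trans _ _ (L * Num.sqrt
      ((clamp a b r - clamp a b r') ^+ 2 + (clamp a b s - clamp a b s') ^+ 2))).
    by rewrite ler_wpM2r ?sqrtr_ge0// ler_norm.
  by rewrite ler_wpM2l// sqrt_sum_sqr_le.
have ftK r s : `|ft r - ft s| <= K * `|r - s|.
  rewrite (le_trans (hf _ _ _ _))//.
  rewrite (@le_trans _ _ (K * `|clamp a b r - clamp a b s|))//.
    by rewrite ler_wpM2r// ler_norm.
  by rewrite ler_wpM2l// clamp_dist.
have GtL r s r' s' : `|Gt r s - Gt r' s'| <= L * (`|r - r'| + `|s - s'|).
  by rewrite (le_trans (Gd _ _ _ _))// ler_wpM2l// lerD// clamp_dist.
have GtC r s : `|Gt r s| <= C.
  have aI : a \in `[a, b] by rewrite in_itv/= lexx.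
  have ca : clamp a b a = a by rewrite clamp_id.
  have Gaa : Gt a a = G a a by rewrite /Gt ca.
  have cab q : `|clamp a b q - a| <= b - a.
    have := cI q; rewrite in_itv/= => /andP[aq qb].
    by rewrite ger0_norm ?subr_ge0// lerD2r.
  rewrite -[Gt r s](subrK (Gt a a)) addrC (le_trans (ler_normD _ _))//.
  rewrite Gaa lerD2l -Gaa (le_trans (Gd _ _ _ _))// ca ler_wpM2l//.
  by rewrite lerD.
have C0 : 0 <= C by apply: le_trans (GtC 0 0).
exists (K + L + L), C; split => //; first by rewrite !addr_ge0.
move=> W gW N z x N0 [zO dz _] [xS [x' [Lx' dx _ x'E]]].
have Lx t : 0 <= t -> inL2 (x t) by move=> /xS[].
exists (fun t => step (network_rhs f G W (z t)) - x' t); split.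
- by move=> t t0; apply: inL2B; [exact: inL2_step|exact: Lx].
- by move=> t t0; apply: inL2B; [exact: inL2_step|exact: Lx'].
- move=> t t0.
  apply: (@step_network_derivative _ _ z (fun s => network_rhs f G W (z s))) => //.
  + exact: Lx'.
  + exact: (dz t t0).
  + exact: dx.
move=> t t0.
have mW : measurable_fun (@sqI R) W by case: gW.
have zt y : unitI y -> step (z t) y \in `[a, b].
  by move=> /(cell_cover N0)[i iy]; rewrite (step_cell _ iy); exact: zO.
have ff' r : `[a, b]%classic r -> f r = ft r by move=> rab; rewrite /ft clamp_id.
have GG' r s : `[a, b]%classic r -> `[a, b]%classic s -> G r s = Gt r s.
  by move=> rab sab; rewrite /Gt !clamp_id.
apply: (@graphon_rhs_nrm_dist _ ft Gt K L C _ _ _ ftK GtL GtC) => //.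
- by apply: measurable_funTS; exact: measurable_step_kernel.
- by move=> p _; apply: step_kernel_bound => // i j; exact: WN_bound.
- by move=> p; exact: graphon_bound.
- exact: inL2_step.
- exact: Lx.
- by apply: inL2B; [exact: inL2_step|exact: Lx'].
have [_ xO] := xS t t0.
have aI : {ae @lebI R, forall y, unitI y} by apply: aeI.
move: (ae_lebI_and (ae_lebI_and xO (x'E t t0)) aI).
apply: ae_lebI_imply => y [[xy x'y] Iy].
rewrite !fctE x'y step_network_rhs//; congr (_ - _).
  apply: (eq_graphon_rhs _ ff' GG'); last exact: zt.
  by apply: aeI => s /zt.
exact: (eq_graphon_rhs _ ff' GG').
Qed.

End Convergence.

Theorem theorem5 (R : realType) (a b : R) (hab : a <= b)
    (f : R -> R) (Lf : R)
    (hf : forall u u', u \in `[a, b] -> u' \in `[a, b] ->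
      `|f u - f u'| <= Lf * `|u - u'|)
    (G : R -> R -> R) (LG : R)
    (hG : forall u v u' v', u \in `[a, b] -> v \in `[a, b] ->
      u' \in `[a, b] -> v' \in `[a, b] ->
      `|G u v - G u' v'| <= LG * Num.sqrt ((u - u') ^+ 2 + (v - v') ^+ 2))
    (W : R * R -> R) (hW : graphon W) (hWc : ae_continuous W)
    (hinv : positively_invariant `[a, b] f G W)
    (xN : forall N : nat, R -> 'rV[R]_N)
    (hxN : forall N : nat, (0 < N)%N ->
      network_solution `[a, b] f G W (xN N))
    (x : R -> R -> R) (hx : graphon_solution `[a, b] f G W x)
    (h0 : L2norm (step (xN N 0) - x 0) @[N --> \oo] --> 0%E)
    (T : R) (hT : 0 < T) :
  exists M : nat -> \bar R,
    (forall N : nat, (0 < N)%N ->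
      is_max [set L2norm (step (xN N t) - x t) | t in `[0, T]] (M N)) /\
    M N @[N --> \oo] --> 0%E.
Proof.
have [K [C [K0 C0 KC]]] := network_error_derivative hab hf hG.
pose phi N t := nrm (step (xN N t) - x t).
pose delta N := fine (\int[@lebesgue_measure R \x @lebesgue_measure R]_(p in @sqI R)
   `|step_kernel (WN W N) p - W p|%:E)%E.
pose c N := C * Num.sqrt (2 * delta N).
(* The term 1/(N+1) makes A N larger than c N, as gronwall_dini demands, and
   still vanishes in the limit. *)
pose A N := phi N 0 + c N + N.+1%:R^-1.
have c0 N : 0 <= c N by rewrite mulr_ge0// sqrtr_ge0.
have bound N : (0 < N)%N -> [/\ forall t, 0 <= t -> inL2 (step (xN N t) - x t),
    forall t, 0 <= t -> phi N t <= A N * expR ((K + 1) * t) &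
    {within `[0, T], continuous (phi N)}].
  move=> N0; have [E' [LE LE' dE E'b]] := KC W hW N (xN N) x N0 (hxN N N0) hx.
  split => //; last exact: (nrm_within_continuous LE LE' dE).
  move=> t t0; apply: (@gronwall_dini _ (phi N) K (c N)) => //.
  - by rewrite !addr_ge0 ?nrm_ge0.
  - by move=> s s0 e e0; exact: (nrm_continuous LE LE' dE s0 e0).
  - move=> s s0 e e0; have [d d0 dP] := nrm_increment LE LE' dE s0 e0.
    exists d => // h h_gt0 hd.
    have := dP h; rewrite gtr0_norm// => /(_ hd (addr_ge0 s0 (ltW h_gt0))).
    rewrite -/(phi N s) -/(phi N (s + h)) => /(le_trans (ler_norm _)).
    rewrite lerBlDl => /le_trans; apply; rewrite lerD2l ler_wpM2l ?(ltW h_gt0)//.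
    by rewrite lerD2r E'b.
  - by rewrite /A -addrA lerDl addr_ge0.
  - by rewrite /A addrAC ltr_pwDl// ltr_wpDl ?nrm_ge0.
have T0 := ltW hT.
have /choice[M MP] : forall N, exists m, (0 < N)%N ->
    is_max [set L2norm (step (xN N t) - x t) | t in `[0, T]] m.
  move=> [|N]; first by exists 0%E.
  have [LE _ phic] := bound N.+1 isT.
  have [tm tmT tmax] := EVT_max T0 phic.
  have t0 t : t \in `[0, T] -> 0 <= t by rewrite in_itv/= => /andP[].
  exists (L2norm (step (xN N.+1 tm) - x tm)) => _; split; first by exists tm.
  move=> _ [t tT <-]; rewrite !nrmE ?lee_fin; [exact: tmax|exact/LE/t0|exact/LE/t0].
exists M; split => //.
have phi0 : phi N 0 @[N --> \oo] --> 0 by exact: (fine_cvg h0).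
have delta0 : delta N @[N --> \oo] --> 0.
  exact: (fine_cvg (step_kernel_WN_L1 hW hWc)).
have c_cvg : c N @[N --> \oo] --> 0.
  rewrite -(mulr0 C); apply: cvgMr.
  rewrite -(@sqrtr0 R) -(mulr0 2).
  by apply: (cvg_comp _ _ (cvgMr delta0)); exact: sqrt_continuous.
have A_cvg : A N * expR ((K + 1) * T) @[N --> \oo] --> 0.
  rewrite -(mul0r (expR ((K + 1) * T))); apply: cvgMl.
  rewrite -(addr0 0) -{1}(addr0 0); apply: cvgD; first exact: cvgD.
  exact: cvg_harmonic.
apply: (@squeeze_cvge _ _ _ _ (cst 0%E) _ (fun N => (A N * expR ((K + 1) * T))%:E)).
- near=> N.
  have N0 : (0 < N)%N by near: N; exact: nbhs_infty_gt.
  have [[t tT <-] _] := MP N N0.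
  move: tT; rewrite /= in_itv/= => /andP[t0 tT].
  have [LE phiA _] := bound N N0.
  apply/andP; split; first exact: L2norm_ge0.
  rewrite (nrmE (LE t t0)) lee_fin; apply: (le_trans (phiA t t0)).
  rewrite ler_wpM2l ?ler_expR ?ler_wpM2l ?addr_ge0//.
    by rewrite nrm_ge0.
- exact: cvg_cst.
- by apply: cvg_EFin; first by apply: nearW.
Unshelve. all: by end_near. Qed.
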